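(* Let $T:V\to L$ be an $\mathcal{O}$-operator on a LieRep pair $(L,[\cdot,\cdot];\rho)$, with $\rho:L\to End(V)$, and let $\varphi\in Z_T^2(V,L)$ be a $2$-cocycle for the cohomology of the $\mathcal{O}$-operator $T$ on the LieRep pair $(L,[\cdot,\cdot];\rho)$. Then $\omega(u,v,w)=\varphi([u,v]_T,w)-\rho_T(w)\varphi(u,v)$ is a $3$-cocycle for the cohomology of the $\mathcal{O}$-operator $T$ on the L.t.sRep pair $(L,[\cdot,\cdot,\cdot];\theta_\rho)$, where $[x,y,z]=[[x,y],z]$ and $\theta_\rho(x,y)=\rho(y)\rho(x)$.
   Context: All vector spaces are over a field of characteristic $0$. A LieRep pair $(L,[\cdot,\cdot];\rho)$ is a Lie algebra $L$ together with a representation $\rho:L\to End(V)$ on a vector space $V$. A linear map $T:V\to L$ is an $\mathcal{O}$-operator on it if $[Tu,Tv]=T\big(\rho(Tu)v-\rho(Tv)u\big)$ for all $u,v\in V$. Then $V$ is a Lie algebra under $[u,v]_T=\rho(Tu)v-\rho(Tv)u$, and $\rho_T(u)x=[Tu,x]+T\rho(x)u$ is a representation of it on $L$. The cohomology of $T$ on the LieRep pair is the Chevalley–Eilenberg cohomology of $(V,[\cdot,\cdot]_T)$ with coefficients in $(L,\rho_T)$; thus $Z_T^2(V,L)$ is the space of skew-symmetric bilinear maps $\varphi:V\times V\to L$ with $-\varphi([u_1,u_2]_T,u_3)+\varphi([u_1,u_3]_T,u_2)-\varphi([u_2,u_3]_T,u_1)+\rho_T(u_1)\varphi(u_2,u_3)-\rho_T(u_2)\varphi(u_1,u_3)+\rho_T(u_3)\varphi(u_1,u_2)=0$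 for all $u_i\in V$. With $[x,y,z]=[[x,y],z]$, $L$ is a Lie triple system and $\theta=\theta_\rho$ is a representation of it on $V$ (a L.t.sRep pair); put $D(x,y)=\theta(y,x)-\theta(x,y)$. $T$ is then also an $\mathcal{O}$-operator on this L.t.sRep pair, i.e. $[Tu,Tv,Tw]=T\big(D(Tu,Tv)w+\theta(Tv,Tw)u-\theta(Tu,Tw)v\big)$. Accordingly $V$ is a Lie triple system under $[u,v,w]_T=D(Tu,Tv)w+\theta(Tv,Tw)u-\theta(Tu,Tw)v$, with representation on $L$ given by $\theta_T(u,v)x=[x,Tu,Tv]+T\big(\theta(x,Tv)u-D(x,Tu)v\big)$; put $D_T(u,v)=\theta_T(v,u)-\theta_T(u,v)$. A $3$-cocycle for the cohomology of $T$ on the L.t.sRep pair is a trilinear map $f:V^3\to L$ such that for all elements of $V$: $f(v_1,v_1,v_2)=0$; $f(v_1,v_2,v_3)+f(v_2,v_3,v_1)+f(v_3,v_1,v_2)=0$; and $f(v_1,v_2,[u_1,u_2,u_3]_T)+D_T(v_1,v_2)f(u_1,u_2,u_3)=f([v_1,v_2,u_1]_T,u_2,u_3)+f(u_1,[v_1,v_2,u_2]_T,u_3)+f(u_1,u_2,[v_1,v_2,u_3]_T)+\theta_T(u_2,u_3)f(v_1,v_2,u_1)-\theta_T(u_1,u_3)f(v_1,v_2,u_2)+D_T(u_1,u_2)f(v_1,v_2,u_3)$. *)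

(* Defs.v *)
From mathcomp Require Import all_boot all_algebra.

Set Implicit Arguments.
Unset Strict Implicit.
Unset Printing Implicit Defensive.

Import GRing.Theory.
Local Open Scope ring_scope.

Definition trilinear (K : fieldType) (U1 U2 U3 W : lmodType K)
    (f : U1 -> U2 -> U3 -> W) : Prop :=
  [/\ forall y z, linear (fun x => f x y z),
      forall x z, linear (fun y => f x y z)
    & forall x y, linear (fun z => f x y z)].

Record lieAlgebra (K : fieldType) (L : lmodType K) := LieAlgebra {
  lie_br :> {bilinear L -> L -> L};
  lie_brxx : forall x, lie_br x x = 0;
  lie_jacobi : forall x y z,
    lie_br (lie_br x y) z + lie_br (lie_br y z) x + lie_br (lie_br z x) y = 0 }.

(* The linear map L -> End(V) is encoded as a bilinear map L -> V -> V. *)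
Record lieRepPair (K : fieldType) (L V : lmodType K) := LieRepPair {
  lr_br : lieAlgebra L;
  lr_rho : {bilinear L -> V -> V};
  lr_rho_br : forall x y v,
    lr_rho (lr_br x y) v = lr_rho x (lr_rho y v) - lr_rho y (lr_rho x v) }.

Record lieOOperator (K : fieldType) (L V : lmodType K)
    (P : lieRepPair L V) := LieOOperator {
  lie_oop :> {linear V -> L};
  lie_oopP : forall u v,
    lr_br P (lie_oop u) (lie_oop v)
    = lie_oop (lr_rho P (lie_oop u) v - lr_rho P (lie_oop v) u) }.

Definition lie_brT (K : fieldType) (L V : lmodType K) (P : lieRepPair L V)
    (T : lieOOperator P) (u v : V) : V :=
  lr_rho P (T u) v - lr_rho P (T v) u.

Definition lie_rhoT (K : fieldType) (L V : lmodType K) (P : lieRepPair L V)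
    (T : lieOOperator P) (u : V) (x : L) : L :=
  lr_br P (T u) x + T (lr_rho P x u).

(* Membership in Z^2_T(V, L). *)
Definition lie_cocycle2 (K : fieldType) (L V : lmodType K)
    (P : lieRepPair L V) (T : lieOOperator P)
    (phi : {bilinear V -> V -> L}) : Prop :=
  (forall u v, phi u v = - phi v u) /\
  (forall u1 u2 u3,
     - phi (lie_brT T u1 u2) u3 + phi (lie_brT T u1 u3) u2
     - phi (lie_brT T u2 u3) u1 + lie_rhoT T u1 (phi u2 u3)
     - lie_rhoT T u2 (phi u1 u3) + lie_rhoT T u3 (phi u1 u2) = 0).

Record lieTripleSystem (K : fieldType) (L : lmodType K) := LieTripleSystem {
  lts_br :> L -> L -> L -> L;
  lts_br_lin : trilinear lts_br;
  lts_brxx : forall x y, lts_br x x y = 0;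
  lts_cyclic : forall x y z, lts_br x y z + lts_br y z x + lts_br z x y = 0;
  lts_fund : forall x y u v w,
    lts_br x y (lts_br u v w)
    = lts_br (lts_br x y u) v w + lts_br u (lts_br x y v) w
      + lts_br u v (lts_br x y w) }.

Definition ltsD (K : fieldType) (L V W : lmodType K)
    (theta : L -> L -> V -> W) (x y : L) (v : V) : W :=
  theta y x v - theta x y v.

(* Representations in the sense of Yamaguti; the bilinear map
   L x L -> End(V) is encoded as a trilinear map L -> L -> V -> V. *)
Record ltsRepPair (K : fieldType) (L V : lmodType K) := LtsRepPair {
  lt_br : lieTripleSystem L;
  lt_theta : L -> L -> V -> V;
  lt_theta_lin : trilinear lt_theta;
  lt_theta_theta : forall x y z w v,
    lt_theta z w (lt_theta x y v) - lt_theta y w (lt_theta x z v)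
    - lt_theta x (lt_br y z w) v + ltsD lt_theta y z (lt_theta x w v) = 0;
  lt_theta_D : forall x y z w v,
    lt_theta z w (ltsD lt_theta x y v) - ltsD lt_theta x y (lt_theta z w v)
    + lt_theta (lt_br x y z) w v + lt_theta z (lt_br x y w) v = 0 }.

Record ltsOOperator (K : fieldType) (L V : lmodType K)
    (Q : ltsRepPair L V) := LtsOOperator {
  lts_oop :> {linear V -> L};
  lts_oopP : forall u v w,
    lt_br Q (lts_oop u) (lts_oop v) (lts_oop w)
    = lts_oop (ltsD (lt_theta Q) (lts_oop u) (lts_oop v) w
               + lt_theta Q (lts_oop v) (lts_oop w) u
               - lt_theta Q (lts_oop u) (lts_oop w) v) }.

Definition lts_brT (K : fieldType) (L V : lmodType K) (Q : ltsRepPair L V)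
    (T : ltsOOperator Q) (u v w : V) : V :=
  ltsD (lt_theta Q) (T u) (T v) w + lt_theta Q (T v) (T w) u
  - lt_theta Q (T u) (T w) v.

Definition lts_thetaT (K : fieldType) (L V : lmodType K) (Q : ltsRepPair L V)
    (T : ltsOOperator Q) (u v : V) (x : L) : L :=
  lt_br Q x (T u) (T v)
  + T (lt_theta Q x (T v) u - ltsD (lt_theta Q) x (T u) v).

Definition lts_DT (K : fieldType) (L V : lmodType K) (Q : ltsRepPair L V)
    (T : ltsOOperator Q) : V -> V -> L -> L :=
  ltsD (lts_thetaT T).

Definition lts_cocycle3 (K : fieldType) (L V : lmodType K)
    (Q : ltsRepPair L V) (T : ltsOOperator Q) (f : V -> V -> V -> L) : Prop :=
  [/\ trilinear f,
      forall v1 v2, f v1 v1 v2 = 0,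
      forall v1 v2 v3, f v1 v2 v3 + f v2 v3 v1 + f v3 v1 v2 = 0
    & forall v1 v2 u1 u2 u3,
        f v1 v2 (lts_brT T u1 u2 u3) + lts_DT T v1 v2 (f u1 u2 u3)
        = f (lts_brT T v1 v2 u1) u2 u3 + f u1 (lts_brT T v1 v2 u2) u3
          + f u1 u2 (lts_brT T v1 v2 u3)
          + lts_thetaT T u2 u3 (f v1 v2 u1) - lts_thetaT T u1 u3 (f v1 v2 u2)
          + lts_DT T u1 u2 (f v1 v2 u3)].

Definition lie_triple (K : fieldType) (L : lmodType K) (A : lieAlgebra L)
    (x y z : L) : L :=
  A (A x y) z.

Definition theta_rho (K : fieldType) (L V : lmodType K) (P : lieRepPair L V)
    (x y : L) (v : V) : V :=
  lr_rho P y (lr_rho P x v).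

Section LieToLts.
Context (K : fieldType) (L V : lmodType K).

Lemma lie_brC (A : lieAlgebra L) x y : A x y = - A y x.
Proof.
apply/eqP; rewrite -addr_eq0; apply/eqP.
have := lie_brxx A (x + y).
by rewrite linearDl !linearDr !lie_brxx add0r addr0.
Qed.

Lemma lie_triple_lin (A : lieAlgebra L) : trilinear (lie_triple A).
Proof.
rewrite /lie_triple; split=> [y z a x x'|x z a y y'|x y a z z'].
- by rewrite !linearPl.
- by rewrite linearPr linearPl.
- by rewrite linearPr.
Qed.

Lemma lie_triplexx (A : lieAlgebra L) x y : lie_triple A x x y = 0.
Proof. by rewrite /lie_triple lie_brxx linear0l. Qed.

Lemma lie_der (A : lieAlgebra L) x y z : A x (A y z) = A (A x y) z + A y (A x z).
Proof.
have /eqP := lie_jacobi A x y z.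
rewrite (lie_brC A x (A y z)) (lie_brC A y (A x z)) (lie_brC A x z).
by rewrite linearNl opprK addrAC addr_eq0 => /eqP ->.
Qed.

Lemma lie_triple_fund (A : lieAlgebra L) x y u v w :
  lie_triple A x y (lie_triple A u v w)
  = lie_triple A (lie_triple A x y u) v w + lie_triple A u (lie_triple A x y v) w
    + lie_triple A u v (lie_triple A x y w).
Proof. by rewrite /lie_triple lie_der (lie_der A _ u v) linearDl. Qed.

Definition lts_of_lie (A : lieAlgebra L) : lieTripleSystem L :=
  LieTripleSystem (lie_triple_lin A) (lie_triplexx A)
    (lie_jacobi A) (lie_triple_fund A).

Lemma theta_rho_lin (P : lieRepPair L V) : trilinear (theta_rho P).
Proof.
rewrite /theta_rho; split=> [y z a x x'|x z a y y'|x y a z z'].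
- by rewrite linearPl linearPr.
- by rewrite linearPl.
- by rewrite !linearPr.
Qed.

Lemma ltsD_theta_rho (P : lieRepPair L V) x y v :
  ltsD (theta_rho P) x y v = lr_rho P (lr_br P x y) v.
Proof. by rewrite lr_rho_br. Qed.

Lemma theta_rho_theta (P : lieRepPair L V) x y z w v :
  theta_rho P z w (theta_rho P x y v) - theta_rho P y w (theta_rho P x z v)
  - theta_rho P x (lts_of_lie (lr_br P) y z w) v
  + ltsD (theta_rho P) y z (theta_rho P x w v) = 0.
Proof.
rewrite ltsD_theta_rho /theta_rho /= /lie_triple.
set u := lr_rho P x v; set c := lr_br P y z.
rewrite (lr_rho_br P c) -linearBr.
have -> : lr_rho P z (lr_rho P y u) - lr_rho P y (lr_rho P z u) = - lr_rho P c u.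
  by rewrite lr_rho_br opprB.
by rewrite linearNr opprB addrA addNr add0r addNr.
Qed.

Lemma theta_rho_D (P : lieRepPair L V) x y z w v :
  theta_rho P z w (ltsD (theta_rho P) x y v)
  - ltsD (theta_rho P) x y (theta_rho P z w v)
  + theta_rho P (lts_of_lie (lr_br P) x y z) w v
  + theta_rho P z (lts_of_lie (lr_br P) x y w) v = 0.
Proof.
rewrite !ltsD_theta_rho /theta_rho /= /lie_triple.
set c := lr_br P x y.
rewrite !(lr_rho_br P c) linearBr.
by rewrite addrAC subrKA subrKA subrr.
Qed.

Definition lts_of_lieRep (P : lieRepPair L V) : ltsRepPair L V :=
  @LtsRepPair K L V (lts_of_lie (lr_br P)) (theta_rho P)
    (theta_rho_lin P) (@theta_rho_theta P) (@theta_rho_D P).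

Lemma lts_oop_of_lieP (P : lieRepPair L V) (T : lieOOperator P) u v w :
  lt_br (lts_of_lieRep P) (T u) (T v) (T w)
  = T (ltsD (lt_theta (lts_of_lieRep P)) (T u) (T v) w
       + lt_theta (lts_of_lieRep P) (T v) (T w) u
       - lt_theta (lts_of_lieRep P) (T u) (T w) v).
Proof.
rewrite /= ltsD_theta_rho /lie_triple /theta_rho.
rewrite {1}(lie_oopP T u v) lie_oopP -(lie_oopP T u v) linearBr opprB.
by rewrite addrA.
Qed.

Definition lts_oop_of_lie (P : lieRepPair L V) (T : lieOOperator P) :
    ltsOOperator (lts_of_lieRep P) :=
  @LtsOOperator K L V (lts_of_lieRep P) T (lts_oop_of_lieP T).

End LieToLts.

(* Main.v *)
Require Import Defs.
From HB Require Import structures.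
From mathcomp Require Import all_boot all_algebra.
Local Open Scope ring_scope.

Set Implicit Arguments.
Unset Strict Implicit.
Unset Printing Implicit Defensive.

Import GRing.Theory.

(** A 2-cocycle phi of a Lie algebra A with values in a representation M is
    the same thing as an abelian extension: it turns A + M into a Lie algebra
    E with [(u, x), (v, y)] = ([u, v], u.y - v.x + phi(u, v)). Passing to
    triple products, E becomes a Lie triple system, and for elements of A

      [[(u, 0), (v, 0)], (w, 0)] = ([[u, v], w], omega(u, v, w)),

    where omega(u, v, w) = phi([u, v], w) - w.phi(u, v). So E is also an
    abelian extension of the Lie triple system A, with cocycle omega: reading
    off the M-component of the axioms of the triple system E on elements of A
    gives exactly the identities required of a 3-cocycle
    ([cochain_triplexx], [cochain_triple_fund]), without expanding any identity
    in five variables. The vanishing of the cyclic sum of omega is the cocycle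
    identity of phi itself.

    This is applied to A = V with the bracket [u, v]_T and to M = L with the
    action rho_T; these form a LieRep pair ([lieRepT]). It remains to see that
    the triple system and the representation which T induces from the triple
    data on L and V are those that come from this LieRep pair:
    [u, v, w]_T = [[u, v]_T, w]_T ([lts_brTE]) and
    theta_T(u, v) = rho_T(v) rho_T(u) ([lts_thetaTE]). Characteristic 0 serves
    to pass from skew-symmetric to alternating. *)

Section AbelianExtension.
Context (K : fieldType) (V M : lmodType K) (P : lieRepPair V M).
Context (phi : {bilinear V -> V -> M}).

Local Notation br := (lr_br P).
Local Notation rho := (lr_rho P).

(** The 3-cochain omega of the introduction. *)
Definition cochain_triple (u v w : V) : M :=
  phi (br u v) w - rho w (phi u v).

Lemma cochain_triple_lin : trilinear cochain_triple.
Proof.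
rewrite /cochain_triple; split=> [y z a x x'|x z a y y'|x y a z z'].
- by rewrite !(linearPl, linearPr) scalerBr opprD addrACA.
- by rewrite !linearPr linearPl scalerBr opprD addrACA.
- by rewrite linearPr linearPl scalerBr opprD addrACA.
Qed.

Definition ext_br (p q : (V * M)%type) : (V * M)%type :=
  (br p.1 q.1, rho p.1 q.2 - rho q.1 p.2 + phi p.1 q.1).

Lemma ext_br_bilinear : bilinear_for *:%R *:%R ext_br.
Proof.
split=> [q a p p'|p a q q']; rewrite /ext_br; congr pair => /=.
- by rewrite linearPl.
- by rewrite !linearPl linearPr !(scalerDr, scalerN) opprD !addrA
    [LHS](ACl (1*3*5*2*4*6))%AC.
- by rewrite linearPr.
- by rewrite !linearPr linearPl !(scalerDr, scalerN) opprD !addrA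
    [LHS](ACl (1*3*5*2*4*6))%AC.
Qed.

HB.instance Definition _ :=
  bilinear_isBilinear.Build K (V * M)%type (V * M)%type (V * M)%type
    *:%R *:%R ext_br ext_br_bilinear.

(** The iterated bracket is computed before any assumption on phi, so that it
    serves both to prove the Jacobi identity of the extension and to describe
    its triple product. *)
Lemma ext_brbr p q s :
  ext_br (ext_br p q) s
  = (br (br p.1 q.1) s.1,
     cochain_triple p.1 q.1 s.1
     + (rho p.1 (rho q.1 s.2) - rho q.1 (rho p.1 s.2))
     - rho s.1 (rho p.1 q.2) + rho s.1 (rho q.1 p.2)).
Proof.
rewrite /ext_br /cochain_triple /=; congr pair.
rewrite lr_rho_br linearDr linearBr !opprD opprK !addrA.
by rewrite [LHS](ACl (6*5*1*2*3*4))%AC.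
Qed.

(* The second assumption is the Chevalley-Eilenberg cocycle identity of the
   alternating map phi, with the signs absorbed into a cyclic sum. *)
Context (phi_alt : forall u, phi u u = 0).
Context (phi_closed : forall u v w,
  cochain_triple u v w + cochain_triple v w u + cochain_triple w u v = 0).

Lemma ext_brxx p : ext_br p p = 0.
Proof. by rewrite /ext_br lie_brxx phi_alt subrr addr0. Qed.

(** In the M-component of the cyclic sum, the twelve terms of the form
    u.(v.x) cancel in pairs, the action of a bracket having been written as a
    commutator; what is left is the cyclic sum of omega. *)
Lemma ext_jacobi p q s :
  ext_br (ext_br p q) s + ext_br (ext_br q s) p + ext_br (ext_br s p) q = 0.
Proof.
rewrite !ext_brbr; apply: injective_projections; rewrite /= ?lie_jacobi //.
have := phi_closed p.1 q.1 s.1.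
(* Atoms are needed: addrA would see through the definition of omega. *)
move: (cochain_triple p.1 _ _) (cochain_triple q.1 _ _)
  (cochain_triple s.1 _ _) => a b c <-; rewrite !addrA.
rewrite [LHS](ACl ((1*6*11)*(2*9)*(15*3)*(12*4)*(5*8)*(7*14)*(10*13)))%AC /=.
by rewrite !subrr !addr0.
Qed.

Definition ext_lie : lieAlgebra (V * M)%type :=
  LieAlgebra ext_brxx ext_jacobi.

(** The operators by which A acts on M inside the triple system of the
    extension are precisely D and theta of [theta_rho P]; this is why the
    cocycle condition of omega is the one for that representation. *)
Lemma ext_tripleE u v w x y z :
  lie_triple ext_lie (u, x) (v, y) (w, z)
  = (lie_triple br u v w,
     cochain_triple u v w + ltsD (theta_rho P) u v z
     - theta_rho P u w y + theta_rho P v w x).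
Proof. exact: ext_brbr. Qed.

Lemma ext_triple0E u v w :
  lie_triple ext_lie (u, 0) (v, 0) (w, 0)
  = (lie_triple br u v w, cochain_triple u v w).
Proof.
by rewrite ext_tripleE /ltsD /theta_rho !linear0r !subr0 !addr0.
Qed.

Lemma cochain_triplexx u w : cochain_triple u u w = 0.
Proof. by have [_] := etrans (esym (ext_triple0E u u w)) (lie_triplexx _ _ _). Qed.

(** M-component of the fundamental identity of the triple system of the
    extension, evaluated on elements of A. *)
Lemma cochain_triple_fund v1 v2 u1 u2 u3 :
  cochain_triple v1 v2 (lie_triple br u1 u2 u3)
  + ltsD (theta_rho P) v1 v2 (cochain_triple u1 u2 u3)
  = cochain_triple (lie_triple br v1 v2 u1) u2 u3
    + cochain_triple u1 (lie_triple br v1 v2 u2) u3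
    + cochain_triple u1 u2 (lie_triple br v1 v2 u3)
    + theta_rho P u2 u3 (cochain_triple v1 v2 u1)
    - theta_rho P u1 u3 (cochain_triple v1 v2 u2)
    + ltsD (theta_rho P) u1 u2 (cochain_triple v1 v2 u3).
Proof.
have := lie_triple_fund ext_lie (v1, 0) (v2, 0) (u1, 0) (u2, 0) (u3, 0).
rewrite !ext_triple0E !ext_tripleE /ltsD /theta_rho !linear0r.
move/(congr1 snd); rewrite /= !(subr0, addr0) => ->.
by rewrite [LHS](AC (2*2*2) (1*3*5*2*4*6))%AC.
Qed.

End AbelianExtension.

Section InducedStructure.
Context (K : fieldType) (L V : lmodType K) (P : lieRepPair L V).
Context (T : lieOOperator P).

Local Notation br := (lr_br P).
Local Notation rho := (lr_rho P).

Lemma lie_brT_bilinear : bilinear_for *:%R *:%R (lie_brT T).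
Proof.
split=> [v a u u'|u a v v']; rewrite /lie_brT /= (linearP T).
- by rewrite linearPl linearPr scalerBr opprD addrACA.
- by rewrite linearPl linearPr scalerBr opprD addrACA.
Qed.

HB.instance Definition _ :=
  bilinear_isBilinear.Build K V V V *:%R *:%R (lie_brT T) lie_brT_bilinear.

Lemma lie_rhoT_bilinear : bilinear_for *:%R *:%R (lie_rhoT T).
Proof.
split=> [x a u u'|u a x x']; rewrite /lie_rhoT /=.
- by rewrite (linearP T) linearPl linearPr (linearP T) scalerDr addrACA.
- by rewrite linearPr linearPl (linearP T) scalerDr addrACA.
Qed.

HB.instance Definition _ :=
  bilinear_isBilinear.Build K V L L *:%R *:%R (lie_rhoT T) lie_rhoT_bilinear.

Lemma lie_brT_morph u v : T (lie_brT T u v) = br (T u) (T v).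
Proof. by rewrite lie_oopP. Qed.

Lemma lie_brTxx u : lie_brT T u u = 0.
Proof. exact: subrr. Qed.

Lemma lie_brT_jacobi u v w :
  lie_brT T (lie_brT T u v) w + lie_brT T (lie_brT T v w) u
  + lie_brT T (lie_brT T w u) v = 0.
Proof.
have brTbrT a b c : lie_brT T (lie_brT T a b) c
    = rho (T a) (rho (T b) c) - rho (T b) (rho (T a) c)
      - rho (T c) (rho (T a) b) + rho (T c) (rho (T b) a).
  by rewrite {1}/lie_brT lie_brT_morph lr_rho_br linearBr opprB addrA addrAC.
rewrite !brTbrT !addrA.
rewrite [LHS](ACl ((1*7)*(12*2)*(9*3)*(4*6)*(5*11)*(8*10)))%AC /=.
by rewrite !subrr !addr0.
Qed.

Definition lieT : lieAlgebra V := LieAlgebra lie_brTxx lie_brT_jacobi.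

(** The right-hand side is the shape of theta_T for the triple product
    [[x, y], z], so this formula gives [lts_thetaTE] at once; it also makes the
    commutator in [lie_rhoT_rep] easy to evaluate. *)
Lemma lie_rhoT_rhoT u v x :
  lie_rhoT T v (lie_rhoT T u x)
  = br (br x (T u)) (T v) + T (rho (T v) (rho x u) - rho (br x (T u)) v).
Proof.
rewrite /lie_rhoT linearDr lie_oopP linearDl.
rewrite (lie_brC _ (T v)) (lie_brC _ (T u)) linearNl opprK -addrA; congr (_ + _).
by rewrite linearNl -!raddfD /= addrA addrAC subrK.
Qed.

(** In the commutator of rho_T(u) and rho_T(v), the part in the bracket of L is
    settled by the Jacobi identity, and inside T the action of [x, T u] on v is
    expanded with the representation property of rho. *)
Lemma lie_rhoT_rep u v x :
  lie_rhoT T (lie_brT T u v) x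
  = lie_rhoT T u (lie_rhoT T v x) - lie_rhoT T v (lie_rhoT T u x).
Proof.
rewrite !lie_rhoT_rhoT opprD addrACA -raddfB /lie_rhoT lie_brT_morph /=.
congr (_ + T _).
  by rewrite (lie_brC _ _ x) lie_der opprD (lie_brC _ (T u) (br x _)) opprK addrC.
rewrite /lie_brT linearBr !lr_rho_br !opprB.
rewrite opprD opprB !addrA [RHS](ACl (5*3*(1*6)*(2*4)))%AC /=.
by rewrite !subrr !addr0.
Qed.

Definition lieRepT : lieRepPair V L :=
  @LieRepPair K V L lieT (lie_rhoT T) lie_rhoT_rep.

Lemma lts_brTE u v w :
  lts_brT (lts_oop_of_lie T) u v w = lie_triple lieT u v w.
Proof.
rewrite /lts_brT /= ltsD_theta_rho /lie_triple /= {1}/lie_brT lie_brT_morph.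
by rewrite /lie_brT linearBr opprB addrA.
Qed.

Lemma lts_thetaTE u v x :
  lts_thetaT (lts_oop_of_lie T) u v x = theta_rho lieRepT u v x.
Proof.
by rewrite /lts_thetaT /= ltsD_theta_rho {2}/theta_rho /= lie_rhoT_rhoT.
Qed.

End InducedStructure.

Theorem corollary6p8 (K : fieldType) (char0 : [pchar K] =i pred0)
    (L V : lmodType K) (P : lieRepPair L V) (T : lieOOperator P)
    (phi : {bilinear V -> V -> L}) (hphi : lie_cocycle2 T phi) :
  lts_cocycle3 (lts_oop_of_lie T)
    (fun u v w => phi (lie_brT T u v) w - lie_rhoT T w (phi u v)).
Proof.
have [phiC dphi] := hphi.
have phi_alt u : phi u u = 0.
  have /eqP: (2%:R : K) *: phi u u = 0.
    by rewrite scaler_nat mulr2n {2}phiC subrr.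
  rewrite scaler_eq0 => /orP[two0|/eqP//].
  by have := char0 2; rewrite !inE two0.
have phi_closed u v w :
    cochain_triple (lieRepT T) phi u v w
    + cochain_triple (lieRepT T) phi v w u
    + cochain_triple (lieRepT T) phi w u v = 0.
  rewrite /cochain_triple /=.
  rewrite -[RHS]oppr0 -(dphi u v w).
  rewrite (phiC u w) (lie_brC (lieT T) u w : lie_brT T u w = _).
  rewrite !(linearNl, linearNr) /= !opprD !opprK !addrA.
  by rewrite [LHS](ACl (1*7*4*5*6*8*9*2*3))%AC.
split.
- exact: (cochain_triple_lin (lieRepT T) phi).
- exact: (cochain_triplexx phi_alt phi_closed).
- exact: phi_closed.
move=> v1 v2 u1 u2 u3.
have := cochain_triple_fund phi_alt phi_closed v1 v2 u1 u2 u3.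
rewrite /cochain_triple.
by rewrite /lts_DT /ltsD !lts_thetaTE !lts_brTE.
Qed.
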